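(* Let $\mathcal{C}\subseteq\mathbb{F}[z]^n$ be an $(n,k,\delta)$ convolutional code over $\mathbb{F}=\mathbb{F}_q$ with dual code $\widehat{\mathcal{C}}$. Let $r$ and $\widehat r$ be the numbers of nonzero Forney indices of $\mathcal{C}$ and $\widehat{\mathcal{C}}$, respectively, and suppose $r=\delta$ or $\widehat r=\delta$. Then the generalized adjacency matrix $[\Lambda]$ of $\mathcal{C}$ uniquely determines the generalized adjacency matrix $[\widehat\Lambda]$ of $\widehat{\mathcal{C}}$. More precisely, \[ [\widehat{\Lambda}]=q^{-k}\,\mathbf{H}\big(\mathcal{H}[\Lambda]^t\mathcal{H}^{-1}\big):=\big\{q^{-k}\,\mathbf{H}(\mathcal{H}\Lambda'^{\,t}\mathcal{H}^{-1})\ \big|\ \Lambda'\in[\Lambda]\big\}, \] where $\mathbf{H}$ is applied entrywise.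
   Context: Let $\mathbb{F}=\mathbb{F}_q$ be a finite field with $q=p^s$ elements ($p$ prime, $s\in\mathbb{N}$). Vectors are row vectors. Convolutional codes. A $k$-dimensional convolutional code of length $n$ is a submodule $\mathcal{C}=\{uG\mid u\in\mathbb{F}[z]^k\}$ of $\mathbb{F}[z]^n$ where $G\in\mathbb{F}[z]^{k\times n}$ is basic, i.e. $G\tilde G=I_k$ for some $\tilde G\in\mathbb{F}[z]^{n\times k}$; $G$ is called an encoder. The degree $\delta$ of $\mathcal{C}$ is the maximal degree of the $k$-minors of $G$; then $\mathcal{C}$ is an $(n,k,\delta)$ code. An encoder with rows $g_1,\dots,g_k$ is minimal if $\sum_i\deg g_i=\delta$; every code has a minimal encoder, and its row degrees, unique up to ordering, are the Forney indices of $\mathcal{C}$. The dual code is $\widehat{\mathcal{C}}=\{w\in\mathbb{F}[z]^n\mid \sum_j w_jv_j=0\ \forall v\in\mathcal{C}\}$; it is an $(n,n-k,\delta)$ code. Controller canonical form. Let $G$ be a minimal encoder with rows $g_i=\sum_{\nu=0}^{\delta_i}g_{i,\nu}z^\nu$ ($g_{i,\nu}\in\mathbb{F}^n$), ordered so that $\delta_1,\dots,\delta_r>0=\delta_{r+1}=\dots=\delta_k$. For $i\le r$ let $A_i\in\mathbb{F}^{\delta_i\times\delta_i}$ have ones on the first superdiagonal and zeros elsewhere, $B_i=(1,0,\dots,0)\in\mathbb{F}^{\delta_i}$, and let $C_i\in\mathbb{F}^{\delta_i\times n}$ have rows $g_{i,1},\dots,g_{i,\delta_i}$. Then $A=\mathrm{diag}(A_1,\dots,A_r)\in\mathbb{F}^{\delta\times\delta}$,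 $B=\begin{pmatrix}\mathrm{diag}(B_1,\dots,B_r)\\0\end{pmatrix}\in\mathbb{F}^{k\times\delta}$, $C\in\mathbb{F}^{\delta\times n}$ is the vertical stack of $C_1,\dots,C_r$, and $D=G(0)\in\mathbb{F}^{k\times n}$. Adjacency matrix. For finite $S\subseteq\mathbb{F}^n$, $\mathrm{we}(S)=\sum_{a\in S}W^{\mathrm{wt}(a)}\in\mathbb{C}[W]_{\le n}$ (polynomials of degree at most $n$), with $\mathrm{wt}$ the Hamming weight and $\mathrm{we}(\emptyset)=0$. $\Lambda(G)=(\lambda_{X,Y})\in\mathbb{C}[W]^{q^\delta\times q^\delta}$ is indexed by $(X,Y)\in\mathbb{F}^\delta\times\mathbb{F}^\delta$ with $\lambda_{X,Y}=\mathrm{we}(\{XC+uD\mid u\in\mathbb{F}^k,\ Y=XA+uB\})$. Generalized adjacency matrix. For $P\in\mathrm{GL}_\delta(\mathbb{F})$, $\mathcal{P}(P)\in\mathrm{GL}_{q^\delta}(\mathbb{C})$ is the permutation matrix with $\mathcal{P}(P)_{X,Y}=1$ if $Y=XP$ and $0$ otherwise; $\Pi=\{\mathcal{P}(P)\mid P\in\mathrm{GL}_\delta(\mathbb{F})\}$. The generalized adjacency matrix of a code is the set $[\Lambda]=\{\mathcal{P}\Lambda(G)\mathcal{P}^{-1}\mid\mathcal{P}\in\Pi\}$ where $G$ is any minimal encoder of the code; it is a known fact that for two minimal encoders $G_1,G_2$ of the same code $\Lambda(G_1)=\mathcal{P}\Lambda(G_2)\mathcal{P}^{-1}$ for some $\mathcal{P}\in\Pi$,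 so this set is an invariant of the code. $[\widehat\Lambda]$ is the same object for $\widehat{\mathcal{C}}$. MacWilliams objects. $\mathbf{H}:\mathbb{C}[W]_{\le n}\to\mathbb{C}[W]_{\le n}$, $\mathbf{H}(f)(W)=(1+(q-1)W)^n f\big(\tfrac{1-W}{1+(q-1)W}\big)$. Fix a primitive $p$-th root of unity $\zeta\in\mathbb{C}$, let $\tau:\mathbb{F}\to\mathbb{F}_p$, $\tau(a)=\sum_{i=0}^{s-1}a^{p^i}$ be the trace and $\beta(X,Y)=\sum_jX_jY_j$. Then $\mathcal{H}=q^{-\delta/2}\big(\zeta^{\tau(\beta(X,Y))}\big)_{X,Y\in\mathbb{F}^\delta}\in\mathbb{C}^{q^\delta\times q^\delta}$ (an invertible matrix). *)

(* Defs.v *)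
From mathcomp Require Import all_boot all_order all_algebra all_fingroup all_solvable all_field.

Set Implicit Arguments.
Unset Strict Implicit.
Unset Printing Implicit Defensive.

Import GRing.Theory Num.Theory.
Local Open Scope ring_scope.

Section Codes.
Variables (F : finFieldType) (n : nat).

(* A code is a subset of F[z]^n, given as a predicate on row vectors. *)
Definition pvset := 'rV[{poly F}]_n -> Prop.

Definition basic k (G : 'M[{poly F}]_(k, n)) : Prop :=
  exists Gt : 'M[{poly F}]_(n, k), G *m Gt = 1%:M.

Definition encoder k (G : 'M[{poly F}]_(k, n)) (C : pvset) : Prop :=
  basic G /\ forall v, C v <-> exists u : 'rV[{poly F}]_k, v = u *m G.

(* The k-minors are indexed by the increasing maps 'I_k -> 'I_n. *)
Definition minor_degree k (G : 'M[{poly F}]_(k, n)) : nat :=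
  \max_(f : {ffun 'I_k -> 'I_n}
        | [forall i : 'I_k, forall j : 'I_k, (i < j)%N ==> (f i < f j)%N])
    (size (\det (colsub f G))).-1.

Definition conv_code k (delta : nat) (C : pvset) : Prop :=
  exists G : 'M[{poly F}]_(k, n), encoder G C /\ minor_degree G = delta.

Definition row_degree k (G : 'M[{poly F}]_(k, n)) (i : 'I_k) : nat :=
  \max_(j < n) (size (G i j)).-1.

Definition minimal_encoder k (G : 'M[{poly F}]_(k, n)) (C : pvset) : Prop :=
  encoder G C /\ (\sum_(i < k) row_degree G i)%N = minor_degree G.

Definition forney_indices k (C : pvset) (e : seq nat) : Prop :=
  exists2 G : 'M[{poly F}]_(k, n),
    minimal_encoder G C & perm_eq e [seq row_degree G i | i : 'I_k].

Definition dual_code (C : pvset) : pvset :=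
  fun w => forall v, C v -> \sum_(j < n) w 0 j * v 0 j = 0.

(* Controller canonical form.  All rows of G contribute a diagonal block; the
   one of a row of degree 0 has size 0 x 0, and the corresponding row of B is
   zero.  Hence A, B, C are the usual matrices when the rows of degree 0 come
   last, and otherwise differ from them only by the order of the inputs, which
   does not affect the adjacency matrix.  The state space dimension is
   transported along h. *)
Section Controller.
Variables (k delta : nat) (G : 'M[{poly F}]_(k, n)).
Hypothesis h : (\sum_(i < k) row_degree G i)%N = delta.

Definition ccfA : 'M[F]_delta :=
  castmx (h, h) (\mxdiag_(i < k)
    (\matrix_(a < row_degree G i, b < row_degree G i)
       (b == a.+1 :> nat)%:R : 'M[F]_(row_degree G i))).

Definition ccfB : 'M[F]_(k, delta) :=
  castmx (erefl k, h) (\mxrow_(i < k)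
    (\matrix_(a < k, b < row_degree G i)
       ((a == i) && (b == 0 :> nat))%:R : 'M[F]_(k, row_degree G i))).

Definition ccfC : 'M[F]_(delta, n) :=
  castmx (h, erefl n) (\mxcol_(i < k)
    (\matrix_(nu < row_degree G i, j < n)
       (G i j)`_nu.+1 : 'M[F]_(row_degree G i, n))).

Definition ccfD : 'M[F]_(k, n) := map_mx (fun g : {poly F} => g.[0]) G.

End Controller.
End Codes.

Section Adjacency.
Variables (F : finFieldType) (K : numClosedFieldType).

Definition wt n (a : 'rV[F]_n) : nat := #|[set j | a 0 j != 0]|.

Definition we n (S : {set 'rV[F]_n}) : {poly K} := \sum_(a in S) 'X^(wt a).

(* Matrices indexed by F^delta x F^delta: mathcomp matrices of size
   #|F^delta|, the index i standing for the vector enum_val i. *)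
Definition states delta : nat := #|{: 'rV[F]_delta}|.

Definition state_mx (R : Type) delta (f : 'rV[F]_delta -> 'rV[F]_delta -> R) :
    'M[R]_(states delta) :=
  \matrix_(i, j) f (enum_val i) (enum_val j).

Definition adjacency n k delta (G : 'M[{poly F}]_(k, n))
    (h : (\sum_(i < k) row_degree G i)%N = delta) :
    'M[{poly K}]_(states delta) :=
  state_mx (fun X Y => we [set X *m ccfC h + u *m ccfD G
    | u : 'rV[F]_k & Y == X *m ccfA h + u *m ccfB h]).

Definition state_perm delta (P : 'M[F]_delta) : 'M[K]_(states delta) :=
  state_mx (fun X Y => (Y == X *m P)%:R).

Definition constmx m1 m2 (M : 'M[K]_(m1, m2)) : 'M[{poly K}]_(m1, m2) :=
  map_mx polyC M.

(* The set [Lambda], as a predicate on matrices.  G ranges over all minimal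
   encoders of C; they all give the same orbit under conjugation by the
   state_perm P with P invertible. *)
Definition gen_adjacency n k delta (C : pvset F n)
    (L : 'M[{poly K}]_(states delta)) : Prop :=
  exists (G : 'M[{poly F}]_(k, n))
         (h : (\sum_(i < k) row_degree G i)%N = delta)
         (P : 'M[F]_delta),
    [/\ minimal_encoder G C, P \in unitmx &
        L = constmx (state_perm P) *m adjacency h
              *m constmx (invmx (state_perm P))].

(* (1 + (q-1)W)^n f((1-W)/(1+(q-1)W)) as a polynomial, for deg f <= n:
   see mwH_frac below. *)
Definition mwH n (f : {poly K}) : {poly K} :=
  \sum_(i < n.+1)
    f`_i *: ((1 - 'X) ^+ i * (1 + (#|F|%:R - 1) *: 'X) ^+ (n - i)).

(* The trace F -> F_p, with F_p seen as a subfield of F; frob_trace_exp is its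
   representative in {0, ..., p-1}: see frob_trace_expK below. *)
Definition frob_trace (p s : nat) (a : F) : F := \sum_(i < s) a ^+ (p ^ i).

Definition frob_trace_exp (p s : nat) (a : F) : nat :=
  if [pick c : 'I_p | c%:R == frob_trace p s a] is Some c then c else 0%N.

Definition dotv delta (X Y : 'rV[F]_delta) : F := \sum_j X 0 j * Y 0 j.

Definition mwmx (p s : nat) (zeta : K) delta : 'M[K]_(states delta) :=
  (sqrtC (#|F|%:R ^+ delta))^-1 *:
    state_mx (fun X Y => zeta ^+ frob_trace_exp p s (dotv X Y)).

Definition macwilliams (p s : nat) (zeta : K) n k delta
    (L : 'M[{poly K}]_(states delta)) : 'M[{poly K}]_(states delta) :=
  map_mx (fun f : {poly K} => (#|F|%:R ^- k) *: mwH n f)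
    (constmx (mwmx p s zeta delta) *m L^T
       *m constmx (invmx (mwmx p s zeta delta))).

Lemma mwH_frac n (f : {poly K}) : (size f <= n.+1)%N ->
  let d : {poly K} := 1 + (#|F|%:R - 1) *: 'X in
  tofrac (mwH n f) =
  tofrac d ^+ n *
    (map_poly (fun c : K => tofrac c%:P) f).[tofrac (1 - 'X) / tofrac d].
Proof.
move=> sf d.
have d0 : tofrac d != 0.
  rewrite tofrac_eq0; apply/eqP => /(congr1 (fun g : {poly K} => g`_0)).
  rewrite coefD coef1 coefZ coefX mulr0 addr0 coef0 => /eqP.
  by rewrite oner_eq0.
rewrite (@horner_coef_wide _ n.+1); last exact: leq_trans (size_poly _ _) sf.
rewrite /mwH rmorph_sum mulr_sumr; apply: eq_bigr => i _ /=.
have ile : (i <= n)%N by rewrite -ltnS.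
rewrite -mul_polyC !rmorphM !rmorphXn /= coef_map_id0; last first.
  by rewrite polyC0 tofrac0.
rewrite -/d [RHS]mulrCA expr_div_n [tofrac d ^+ n * _]mulrCA.
by rewrite -[X in _ = _ * (_ * (_ ^+ X / _))](subnK ile) exprD mulfK // expf_neq0.
Qed.

Lemma frob_trace_expK p s (a : F) : prime p -> #|F| = (p ^ s)%N ->
  (frob_trace_exp p s a)%:R = frob_trace p s a.
Proof.
move=> pp cF; rewrite /frob_trace_exp; case: pickP => [c /eqP //|no].
have chp := card_finPcharP cF pp.
have fixp : frob_trace p s a ^+ p = frob_trace p s a.
  rewrite -(pFrobenius_autE chp) rmorph_sum /=.
  under eq_bigr => i _ do rewrite pFrobenius_autE -exprM -expnSr.
  rewrite /frob_trace -(big_mkord xpredT (fun i => a ^+ (p ^ i.+1))).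
  rewrite -(big_mkord xpredT (fun i => a ^+ (p ^ i))).
  case: (s) cF => [|m] cF; first by rewrite !big_nil.
  rewrite big_nat_recr //= [RHS]big_nat_recl //= expn0 expr1 addrC.
  by rewrite -cF expf_card.
set x := frob_trace p s a in no fixp *.
pose rs := x :: [seq (c : nat)%:R | c : 'I_p].
have p1 := prime_gt1 pp.
pose Q : {poly F} := 'X^p - 'X.
have sz : size Q = p.+1.
  by rewrite size_polyDl ?size_polyXn // size_polyN size_polyX.
suff : (size rs < size Q)%N.
  by rewrite sz /= size_map size_enum_ord ltnn.
apply: max_poly_roots; first by rewrite -size_poly_gt0 sz.
- rewrite /= rootE !hornerE fixp subrr eqxx /=.
  apply/allP => _ /mapP[c _ ->].
  by rewrite rootE !hornerE -(pFrobenius_autE chp) rmorph_nat subrr.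
- rewrite /= -/rs; apply/andP; split.
    by apply/mapP => -[c _ xc]; have := no c; rewrite -xc eqxx.
  rewrite map_inj_in_uniq ?enum_uniq // => c d _ _ /eqP.
  wlog le_cd : c d / (c <= d)%N => [hw cd|].
    by case: (leqP c d) => [/hw|/ltnW/hw h]; [exact | apply/esym/h; rewrite eq_sym].
  rewrite eq_sym -subr_eq0 -natrB // -(dvdn_pcharf chp) => dv.
  apply/val_inj/eqP; rewrite /= eqn_leq le_cd /= -subn_eq0.
  apply: contraLR dv; rewrite -lt0n => h; rewrite gtnNdvd //.
  exact: leq_ltn_trans (leq_subr _ _) (ltn_ord d).
Qed.

End Adjacency.

(* Main.v *)
Require Import Defs.
From mathcomp Require Import ring zify.
From mathcomp Require Import all_boot all_order all_algebra finfield.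
Import GRing.Theory Num.Theory.
Local Open Scope ring_scope.

Set Implicit Arguments.
Unset Strict Implicit.
Unset Printing Implicit Defensive.

(* For arbitrary Forney indices, let (A, B, C, D) and (A', B', C', D') be the
   controller canonical forms of minimal encoders G of the code and H of its dual.
   Cutting the convolution sums in H G^T = 0 at time 0 yields a bilinear pairing M
   between the two state spaces with
     C' C^T = A' M - M A^T,  C' D^T = - M B^T,  D' C^T = B' M,  D' D^T = 0.
   Minimality makes M nondegenerate, so both codes have the same degree, and after
   a change of basis of the states we may take M = 1.  Then the block codes
   spanned by the transitions (X, output, Y) of the two systems are dual to each
   other up to exchanging the state components and changing one sign, and the
   claim is the block code MacWilliams identity for them. *)

(** * The state pairing of a code and its dual *)

(** [b] may lie outside the range: [ccfA] shifts past the last state of a block, and rows of degree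
    0 have empty blocks. *)
Lemma sum_delta_nat (R : pzSemiRingType) d b (f : nat -> R) :
  (forall c, (d <= c)%N -> f c = 0) ->
  \sum_(c < d) (c == b :> nat)%:R * f c = f b.
Proof.
move=> fd; have [bd|db] := ltnP b d; last first.
  rewrite fd // big1 // => c _; case: eqP => [cb|_]; rewrite ?mul0r //.
  by have := ltn_ord c; rewrite cb ltnNge db.
rewrite (bigD1 (Ordinal bd)) //= eqxx mul1r big1 ?addr0 // => c cb.
by case: eqP => [cb'|_]; rewrite ?mul0r //; case/eqP: cb; apply: val_inj.
Qed.

(** * Degrees of cofactors and predictable degrees *)

Section Degrees.
Variable F : finFieldType.

Lemma size_prod_le (R : nzSemiRingType) (I : finType) (P : pred I)
    (f : I -> {poly R}) (d : I -> nat) :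
  (forall i, P i -> (size (f i) <= (d i).+1)%N) ->
  (size (\prod_(i | P i) f i)%R <= (\sum_(i | P i) d i).+1)%N.
Proof.
move=> fd; elim/big_rec2: _ => [|i m q Pi qm]; first by rewrite size_poly1.
apply: leq_trans (size_polyMleq _ _) _.
by have := fd i Pi; lia.
Qed.

Lemma size_cofactor_le k (A : 'M[{poly F}]_k) (d : 'I_k -> nat) i j :
  (forall l m, (size (A l m) <= (d l).+1)%N) ->
  (size (cofactor A i j) <= (\sum_(l | i != l) d l).+1)%N.
Proof.
move=> Ad; rewrite expand_cofactor.
apply: leq_trans (size_sum _ _ _) _; apply/bigmax_leqP => s _.
by rewrite size_Msign size_prod_le.
Qed.

Lemma size_row_degree k n (G : 'M[{poly F}]_(k, n)) i j :
  (size (G i j) <= (row_degree G i).+1)%N.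
Proof.
apply: leq_trans (leqSpred _) _.
by rewrite ltnS (@leq_bigmax _ (fun j => (size (G i j)).-1)).
Qed.

Lemma nth_row_degree k n (G : 'M[{poly F}]_(k, n)) i j a :
  (row_degree G i < a)%N -> (G i j)`_a = 0.
Proof. by move=> ia; rewrite nth_default // (leq_trans (size_row_degree _ _ _)). Qed.

(* Cramer's rule for a k x k submatrix Q of G of maximal degree:
   y_i det Q = ((y Q) adj Q)_i. *)
Lemma predictable_degree k n (G : 'M[{poly F}]_(k, n)) (y : 'rV_k) N :
  (\sum_(i < k) row_degree G i)%N = minor_degree G ->
  (0 < minor_degree G)%N ->
  (forall j, (size ((y *m G)%R ord0 j) <= N)%N) ->
  forall i, y 0 i != 0 -> (size (y ord0 i) + row_degree G i <= N)%N.
Proof.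
move=> minG dG yG i yi.
(* A minor of maximal degree; [dG] excludes 0, which is also the value for an empty maximum or a
   zero minor. *)
have [f sdet] : exists f : 'I_k -> 'I_n,
    size (\det (colsub f G)) = (\sum_(l < k) row_degree G l).+1.
  rewrite minG; move: dG; rewrite /minor_degree.
  elim/big_ind: _ => // [m1 m2 h1 h2|f _ sf].
    by rewrite /maxn; case: ifP.
  by exists f; rewrite prednK // (leq_trans sf) ?leq_pred.
have Qd l m : (size (colsub f G l m) <= (row_degree G l).+1)%N.
  by rewrite mxE size_row_degree.
have dn0 : \det (colsub f G) != 0 by rewrite -size_poly_gt0 sdet.
have : y 0 i * \det (colsub f G) = (y *m (colsub f G *m \adj (colsub f G))) 0 i.
  by rewrite mul_mx_adj mul_mx_scalar mxE mulrC.
rewrite mulmxA mxE => /(congr1 (fun q : {poly F} => size q)).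
rewrite size_mul // sdet addnS /=.
rewrite (bigD1 i) //= => e.
rewrite -(leq_add2r (\sum_(l < k | l != i) row_degree G l)) -addnA e.
apply: leq_trans (size_sum _ _ _) _; apply/bigmax_leqP => j _.
apply: leq_trans (size_polyMleq _ _) _.
have yGj : (size ((y *m colsub f G)%R ord0 j) <= N)%N.
  have := yG (f j); rewrite !mxE.
  by under [in X in _ -> X]eq_bigr do rewrite mxE.
have := size_cofactor_le i j Qd; rewrite [\adj _ _ _]mxE.
rewrite (eq_bigl (fun l => l != i)); last by move=> l; rewrite eq_sym.
by move=> cle; rewrite -subn1 leq_subLR add1n -addnS leq_add.
Qed.

End Degrees.

Section Pairing.
Variable F : finFieldType.

Definition coef_dot n k1 k2 (H : 'M[{poly F}]_(k1, n)) (G : 'M[{poly F}]_(k2, n))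
    i l s t : F := \sum_j (H i j)`_s * (G l j)`_t.

(* The state pairing: the part of the (a + b + 1)-st coefficient of the
   (vanishing) product of row i of H and row l of G in which the factor from H
   has degree at most b. *)
Definition pairing n k1 k2 (H : 'M[{poly F}]_(k1, n)) (G : 'M[{poly F}]_(k2, n))
    i l b a : F := \sum_(s < b.+1) coef_dot H G i l s ((a + b).+1 - s).

Section Basics.
Variables (n k1 k2 : nat) (H : 'M[{poly F}]_(k1, n)) (G : 'M[{poly F}]_(k2, n)).

Lemma coef_dotC i l s t : coef_dot H G i l s t = coef_dot G H l i t s.
Proof. by apply: eq_bigr => j _; rewrite mulrC. Qed.

Lemma pairing0 i l a : pairing H G i l 0 a = coef_dot H G i l 0 a.+1.
Proof. by rewrite /pairing big_ord1 addn0. Qed.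

(** Both pairings cut the same convolution sum, of total degree [a + b + 2], one term apart. *)
Lemma pairingS i l b a :
  pairing H G i l b.+1 a = pairing H G i l b a.+1 + coef_dot H G i l b.+1 a.+1.
Proof.
rewrite /pairing big_ord_recr /= addnS addSn.
by congr (_ + coef_dot _ _ _ _ _ _); lia.
Qed.

Lemma pairing_out i l b a : (row_degree G l <= a)%N -> pairing H G i l b a = 0.
Proof.
move=> la; rewrite /pairing big1 // => s _; rewrite /coef_dot big1 // => j _.
by rewrite [_`_(_ - _)]nth_row_degree ?mulr0 //; have := ltn_ord s; lia.
Qed.

Lemma coef_dot_conv i l N : (H *m G^T) i l = 0 ->
  \sum_(0 <= s < N.+1) coef_dot H G i l s (N - s) = 0.
Proof.
move=> /(congr1 (fun q : {poly F} => q`_N)); rewrite !mxE coef0 coef_sum => e.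
rewrite -[RHS]e big_mkord /coef_dot exchange_big; apply: eq_bigr => j _.
by rewrite mxE coefM.
Qed.
End Basics.

(** The terms left out of one pairing are those of the other in reverse order, and the full
    convolution sum vanishes. *)
Lemma pairing_antisym n k1 k2 (H : 'M[{poly F}]_(k1, n)) (G : 'M_(k2, n)) i l b a :
  H *m G^T = 0 -> pairing H G i l b a = - pairing G H l i a b.
Proof.
move=> HG; apply/eqP; rewrite -addr_eq0; apply/eqP.
have HGil : (H *m G^T) i l = 0 by rewrite HG mxE.
rewrite -(coef_dot_conv (a + b).+1 HGil) (big_cat_nat (n := b.+1)) //=; last lia.
rewrite /pairing big_mkord; congr (_ + _).
rewrite -[in RHS](add0n b.+1) big_addn big_nat_rev big_mkord.
have -> : ((a + b).+2 - b.+1 = a.+1)%N by lia.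
apply: eq_bigr => s _; rewrite coef_dotC; have := ltn_ord s => sa.
by congr coef_dot; lia.
Qed.

Lemma pairing_out_l n k1 k2 (H : 'M[{poly F}]_(k1, n)) (G : 'M_(k2, n)) i l b a :
  H *m G^T = 0 -> (row_degree H i <= b)%N -> pairing H G i l b a = 0.
Proof. by move=> HG ib; rewrite pairing_antisym // pairing_out ?oppr0. Qed.

Section PairingMatrix.
Variables (n k1 k2 d1 d2 : nat).
Variables (H : 'M[{poly F}]_(k1, n)) (G : 'M[{poly F}]_(k2, n)).
Hypotheses (hH : (\sum_(i < k1) row_degree H i)%N = d1).
Hypotheses (hG : (\sum_(i < k2) row_degree G i)%N = d2).

Definition pairing_mx : 'M[F]_(d1, d2) :=
  castmx (hH, hG) (\mxblock_(i < k1, l < k2)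
    (\matrix_(b < row_degree H i, a < row_degree G l) pairing H G i l b a)).

End PairingMatrix.

Section PairingIdentities.
Variables (n k1 k2 d1 d2 : nat).
Variables (H : 'M[{poly F}]_(k1, n)) (G : 'M[{poly F}]_(k2, n)).
Hypotheses (hH : (\sum_(i < k1) row_degree H i)%N = d1).
Hypotheses (hG : (\sum_(i < k2) row_degree G i)%N = d2).
Hypothesis HG : H *m G^T = 0.
Local Notation M := (pairing_mx hH hG).

(** Entrywise this is [pairingS]: the shift matrices raise [b] or [a] by one, and positions past the
    end contribute 0. *)
Lemma ccfC_mul_tr : ccfC hH *m (ccfC hG)^T = ccfA hH *m M - M *m (ccfA hG)^T.
Proof.
rewrite /ccfC /ccfA /pairing_mx; case: _ / hH; case: _ / hG; rewrite !castmx_id.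
rewrite tr_mxcol mul_mxcol_mxrow tr_mxdiag mul_mxdiag_mxblock mul_mxblock_mxdiag.
rewrite -mxblockB; apply: eq_mxblock => i l; apply/matrixP => b a; rewrite !mxE.
under [X in _ = X - _]eq_bigr do rewrite !mxE.
under [X in _ = _ - X]eq_bigr do rewrite !mxE mulrC.
rewrite (sum_delta_nat b.+1 (f := fun c => pairing H G i l c a)); last first.
  by move=> c; apply: pairing_out_l.
rewrite (sum_delta_nat a.+1 (f := fun c => pairing H G i l b c)); last first.
  by move=> c; apply: pairing_out.
rewrite pairingS [X in _ = X - _]addrC addrK.
by apply: eq_bigr => j _; rewrite !mxE.
Qed.

Lemma ccfD_mul_tr : ccfD H *m (ccfD G)^T = 0.
Proof.
apply/matrixP => i l.
have := congr1 (fun A : 'M[{poly F}]_(_, _) => (A i l).[0]) HG.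
rewrite !mxE horner0 horner_sum => e; rewrite -[RHS]e.
by apply: eq_bigr => j _; rewrite !mxE hornerM.
Qed.

(** [ccfB hG] selects position [a = 0], where antisymmetry leaves a single product; hence the
    sign. *)
Lemma ccfC_mul_trD : ccfC hH *m (ccfD G)^T = - (M *m (ccfB hG)^T).
Proof.
rewrite /ccfC /ccfB /pairing_mx; case: _ / hH; case: _ / hG; rewrite !castmx_id.
rewrite mxcol_mul tr_mxrow mul_mxblock_mxrow -mxcolN.
apply: eq_mxcol => i; apply/matrixP => b l; rewrite !mxE summxE.
rewrite (bigD1 l) //= [X in - (_ + X)]big1 ?addr0 => [|l' ll']; last first.
  by rewrite mxE big1 // => a _; rewrite !mxE eq_sym (negbTE ll') mulr0.
rewrite mxE; under [X in - X]eq_bigr do rewrite !mxE eqxx mulrC.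
rewrite (sum_delta_nat 0 (f := fun a => pairing H G i l b a)); last first.
  by move=> a; apply: pairing_out.
rewrite pairing_antisym // opprK pairing0 coef_dotC; apply: eq_bigr => j _.
by rewrite !mxE horner_coef0.
Qed.

Lemma ccfD_mul_trC : ccfD H *m (ccfC hG)^T = ccfB hH *m M.
Proof.
rewrite /ccfC /ccfB /pairing_mx; case: _ / hH; case: _ / hG; rewrite !castmx_id.
rewrite tr_mxcol mul_mxrow mul_mxrow_mxblock.
apply: eq_mxrow => l; apply/matrixP => i a; rewrite !mxE summxE.
rewrite (bigD1 i) //= [X in _ = _ + X]big1 ?addr0 => [|i' ii']; last first.
  by rewrite mxE big1 // => b _; rewrite !mxE eq_sym (negbTE ii') mul0r.
rewrite mxE; under [RHS]eq_bigr do rewrite !mxE eqxx.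
rewrite (sum_delta_nat 0 (f := fun b => pairing H G i l b a)); last first.
  by move=> b; apply: pairing_out_l.
rewrite pairing0; apply: eq_bigr => j _.
by rewrite !mxE horner_coef0.
Qed.

End PairingIdentities.

(** The dropped row is the output of the system started in the unit state at position [a] of
    register [l] with zero input, so the pairing is a syndrome coefficient of that output. *)
Lemma coef_mul_drop n k1 k2 (H : 'M[{poly F}]_(k1, n)) (G : 'M_(k2, n)) i l b a :
  (\sum_j H i j * drop_poly a.+1 (G l j))`_b = pairing H G i l b a.
Proof.
rewrite coef_sum /pairing /coef_dot exchange_big; apply: eq_bigr => j _ /=.
rewrite coefM; apply: eq_bigr => s _; rewrite coef_drop_poly.
by congr (_ * _`_ _); have := ltn_ord s; lia.
Qed.

(* A state v in the kernel is reached by an input sequence whose output after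
   time 0 is annihilated by H, hence itself a codeword u G; subtracting it leaves
   a codeword that vanishes from time 0 on, and by the predictable degree
   property its input sequence no longer affects the state at time 0. *)
Lemma pairing_mx_tr_free n k1 k2 d1 d2
    (H : 'M[{poly F}]_(k1, n)) (G : 'M[{poly F}]_(k2, n))
    (hH : (\sum_(i < k1) row_degree H i)%N = d1)
    (hG : (\sum_(i < k2) row_degree G i)%N = d2) :
  H *m G^T = 0 -> (\sum_(i < k2) row_degree G i)%N = minor_degree G ->
  (forall w : 'rV_n, H *m w^T = 0 -> exists u, w = u *m G) ->
  row_free (pairing_mx hH hG)^T.
Proof.
move=> HG minG annG; apply: inj_row_free => v.
rewrite /pairing_mx; case: _ / hH; move: v; case: _ / hG => v.
rewrite castmx_id.
rewrite -[v]submxrowK; set x := submxrow v.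
rewrite tr_mxblock mul_mxrow_mxblock => xM.
(* The kernel equations concern [b] below the row degree; beyond it the pairing vanishes. *)
have x0 i b : \sum_l \sum_(a < row_degree G l) x l 0 a * pairing H G i l b a = 0.
  have [ib|bi] := leqP (row_degree H i) b.
    rewrite big1 // => l _; rewrite big1 // => a _.
    by rewrite pairing_out_l ?mulr0.
  have := congr1 (fun A => submxrow A i) xM; rewrite mxrowK.
  move=> /matrixP/(_ 0 (Ordinal bi)); rewrite !mxE summxE => e; rewrite -[RHS]e.
  by apply: eq_bigr => l _; rewrite mxE; apply: eq_bigr => a _; rewrite !mxE.
(* The zero-input output from state [v], from time 0 on. *)
pose w : 'rV_n := \row_j \sum_l \sum_(a < row_degree G l)
  x l 0 a *: drop_poly a.+1 (G l j).
have /annG[u wE] : H *m w^T = 0.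
  apply/matrixP => i j0; rewrite !mxE; apply/polyP => b.
  rewrite coef0 -[RHS](x0 i b).
    under [in LHS]eq_bigr => j _.
    rewrite !mxE mulr_sumr.
    under eq_bigr do (rewrite mulr_sumr; under eq_bigr do rewrite -scalerAr).
    over.
  rewrite exchange_big coef_sum; apply: eq_bigr => l _ /=.
  rewrite exchange_big coef_sum; apply: eq_bigr => a _ /=.
  by rewrite -scaler_sumr coefZ coef_mul_drop.
set N := (\sum_(i < k2) row_degree G i)%N in v x xM x0 w wE minG *.
have ltN l (a : 'I_(row_degree G l)) : (a < N)%N.
  by apply: leq_trans (ltn_ord a) _; rewrite /N (bigD1 l) //= leq_addr.
(* All times are delayed by [N]: the input [x l 0 a] at time [-(a+1)] reaches position [a] at time
   0, and [u] acts from time 0 on. *)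
pose y : 'rV_k2 := \row_l (\sum_(a < row_degree G l) x l 0 a *: 'X^(N - a.+1)
  - 'X^N * u 0 l).
(* The part from time 0 on is cancelled by [u *m G]. *)
have yG j : (size ((y *m G)%R ord0 j) <= N)%N.
  have -> : (y *m G) ord0 j = \sum_l \sum_(a < row_degree G l)
      x l 0 a *: ('X^(N - a.+1) * take_poly a.+1 (G l j)).
    transitivity (\sum_l (\sum_(a < row_degree G l) x l 0 a *: 'X^(N - a.+1))
        * G l j - 'X^N * w 0 j).
      rewrite wE !mxE mulr_sumr -sumrB; apply: eq_bigr => l _.
      by rewrite !mxE mulrBl mulrA.
    rewrite mxE mulr_sumr -sumrB; apply: eq_bigr => l _.
    rewrite mulr_sumr mulr_suml -sumrB; apply: eq_bigr => a _.
    rewrite -scalerAl -scalerAr -scalerBr; congr (_ *: _).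
    rewrite -[X in _ * X - _](poly_take_drop a.+1) mulrDr.
    by rewrite [drop_poly _ _ * _]mulrC mulrA -exprD subnK ?addrK // ltN.
  apply: leq_trans (size_sum _ _ _) _; apply/bigmax_leqP => l _.
  apply: leq_trans (size_sum _ _ _) _; apply/bigmax_leqP => a _.
  apply: leq_trans (size_scale_leq _ _) _.
  apply: leq_trans (size_polyMleq _ _) _; rewrite size_polyXn.
  rewrite addSn /= -[X in (_ <= X)%N](subnK (ltN l a)) leq_add2l.
  exact: size_take_poly.
suff xl l : x l = 0.
  by apply/rowP => c; rewrite mxE xl !mxE.
apply/rowP => a; rewrite [RHS]mxE; apply/eqP/negPn/negP => xa.
have ya : (y 0 l)`_(N - a.+1) = x l 0 a.
  rewrite mxE coefB coefXnM; have := ltN l a => aN.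
  rewrite ifT ?subr0; last lia.
  rewrite coef_sum (bigD1 a) //= coefZ coefXn eqxx mulr1 big1 ?addr0 // => c ca.
  rewrite coefZ coefXn; case: eqP => [e|_]; last by rewrite mulr0.
  case/eqP: ca; apply: val_inj => /=; have := ltN l c; lia.
have yl : y 0 l != 0 by apply: contraNneq xa => y0; rewrite -ya y0 coef0.
have dG : (0 < minor_degree G)%N by rewrite -minG; apply: leq_ltn_trans (ltN l a).
have ysize : (N - a.+1 < size (y ord0 l))%N.
  by rewrite ltnNge; apply: contra xa => sy; rewrite -ya nth_default.
(* The degree bound would force [row_degree G l <= a]. *)
move: (predictable_degree minG dG yG yl) ysize (ltn_ord a) (ltN l a).
by move: (size _) => m; clear; lia.
Qed.

End Pairing.

(** * The MacWilliams identity for linear state space systems *)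

(** The row space of [D'] lies in the kernel of [D^T], and both have dimension [n - k]. *)
Lemma ker_orthogonal (F : fieldType) n k (D : 'M[F]_(k, n)) (D' : 'M[F]_(n - k, n))
    (w : 'rV_n) : row_free D -> row_free D' -> D' *m D^T = 0 -> w *m D^T = 0 ->
  exists u, w = u *m D'.
Proof.
move=> /eqP Df /eqP D'f DD wD.
have DK : (D' <= kermx D^T)%MS by apply/sub_kermxP.
have wK : (w <= kermx D^T)%MS by apply/sub_kermxP.
apply/submxP; apply: submx_trans wK _.
by rewrite -(geq_leqif (mxrank_leqif_sup DK)) mxrank_ker mxrank_tr Df D'f.
Qed.

Lemma invmx_right (R : comUnitRingType) m (A B : 'M[R]_m) : 
  A *m B = 1%:M -> invmx A = B.
Proof.
move=> AB; have [Au _] := mulmx1_unit AB.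
by rewrite -[B]mul1mx -(mulVmx Au) -mulmxA AB mulmx1.
Qed.

Lemma natr_pchar_eq (R : nzRingType) q (a b : nat) : q \in [pchar R] ->
  a%:R = b%:R :> R -> a = b %[mod q].
Proof.
move=> qR; wlog ab : a b / (a <= b)%N => [hw eab|/esym/eqP].
  by case: (leqP a b) => [/hw|/ltnW/hw h]; [exact | apply/esym/h].
rewrite -subr_eq0 -natrB // -(dvdn_pcharf qR) => ?.
by apply/eqP; rewrite eq_sym eqn_mod_dvd.
Qed.

(** * Additive characters and the transform of Hamming weights *)

Section Characters.
Variables (F : finFieldType) (p s : nat).
Hypotheses (p_prime : prime p) (card_F : #|F| = (p ^ s)%N).
Variables (K : numClosedFieldType) (zeta : K).
Hypothesis zeta_prim : p.-primitive_root zeta.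

(** The additive character given by the trace; up to scaling, [mwmx] consists of its values at dot
    products. *)
Definition chi (a : F) : K := zeta ^+ frob_trace_exp p s a.

Lemma pchar_F : p \in [pchar F].
Proof. exact: card_finPcharP card_F p_prime. Qed.

Lemma frob_traceD a b : frob_trace p s (a + b) =
  frob_trace p s a + frob_trace p s b :> F.
Proof.
rewrite /frob_trace -big_split; apply: eq_bigr => i _ /=.
rewrite exprDn_pchar // (eq_pnat _ (pcharf_eq pchar_F)) pnatX pnat_id //.
Qed.

(** Exponents add only modulo [p], which is the order of [zeta]. *)
Lemma chiD a b : chi (a + b) = chi a * chi b.
Proof.
rewrite /chi -exprD; apply/eqP; rewrite (eq_prim_root_expr zeta_prim); apply/eqP.
apply: (natr_pchar_eq pchar_F).
by rewrite natrD !frob_trace_expK // frob_traceD.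
Qed.

Lemma chi_neq0 a : chi a != 0.
Proof.
apply: expf_neq0; apply/eqP => z0; have := prim_expr_order zeta_prim.
by rewrite z0 expr0n gtn_eqF ?prime_gt0 // => /esym/eqP; rewrite oner_eq0.
Qed.

Lemma chi0 : chi 0 = 1.
Proof. by apply: (mulfI (chi_neq0 0)); rewrite -chiD addr0 mulr1. Qed.

Lemma chi_sum (I : Type) (r : seq I) (P : pred I) f :
  chi (\sum_(i <- r | P i) f i) = \prod_(i <- r | P i) chi (f i).
Proof. exact: (big_morph chi chiD chi0). Qed.

(* The trace is a polynomial function of degree p^(s-1) < q. *)
Lemma chi_nontrivial : exists a, chi a != 1.
Proof.
have p1 := prime_gt1 p_prime.
have [a ta|tr0] := pickP (fun a : F => frob_trace p s a != 0).
  exists a; apply: contra ta; rewrite /chi => /eqP e; rewrite -frob_trace_expK //.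
  by rewrite -(dvdn_pcharf pchar_F) (prim_order_dvd zeta_prim) e.
case: s card_F tr0 => [|m] cF tr0.
  by have := finNzRing_gt1 F; rewrite cF.
pose T : {poly F} := \sum_(i < m.+1) 'X^(p ^ i).
have sT : size T = (p ^ m).+1.
  rewrite /T big_ord_recr /= addrC size_polyDl size_polyXn // ltnS.
  apply: leq_trans (size_sum _ _ _) _; apply/bigmax_leqP => i _.
  by rewrite size_polyXn ltn_exp2l.
have : (size (enum F) < size T)%N.
  apply: max_poly_roots; rewrite ?enum_uniq //; first by rewrite -size_poly_gt0 sT.
  apply/allP => a _; rewrite rootE horner_sum.
  under eq_bigr do rewrite hornerXn.
  by have /negbFE := tr0 a.
by rewrite sT ltnS -cardE cF leq_exp2l // ltnn.
Qed.

(** Translation by [x0] multiplies the sum by [chi (l x0)], which is not 1. *)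
Lemma sum_chi_eq0 (V : finZmodType) (l : V -> F) (x0 : V) :
  {morph l : x y / x + y} -> chi (l x0) != 1 -> \sum_x chi (l x) = 0.
Proof.
move=> lD cx; set S := \sum_x _.
have : chi (l x0) * S = S.
  rewrite /S mulr_sumr [RHS](reindex_inj (addrI x0)) /=.
  by apply: eq_bigr => x _; rewrite lD chiD.
move/eqP; rewrite -subr_eq0 -{2}[S]mul1r -mulrBl mulf_eq0 subr_eq0 (negbTE cx).
by move/eqP.
Qed.

Lemma dotvE d (x y : 'rV[F]_d) : dotv x y = (x *m y^T) 0 0.
Proof. by rewrite mxE; apply: eq_bigr => j _; rewrite mxE. Qed.

Lemma dotvDl d (z x y : 'rV[F]_d) : dotv (x + y) z = dotv x z + dotv y z.
Proof. by rewrite !dotvE mulmxDl mxE. Qed.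

Lemma dotvNl d (x z : 'rV[F]_d) : dotv (- x) z = - dotv x z.
Proof. by rewrite !dotvE mulNmx mxE. Qed.

Lemma dotvC d (x y : 'rV[F]_d) : dotv x y = dotv y x.
Proof. by apply: eq_bigr => j _; rewrite mulrC. Qed.

Lemma dotvDr d (z x y : 'rV[F]_d) : dotv z (x + y) = dotv z x + dotv z y.
Proof. by rewrite dotvC dotvDl ![dotv _ z]dotvC. Qed.

Lemma dotvNr d (z x : 'rV[F]_d) : dotv z (- x) = - dotv z x.
Proof. by rewrite dotvC dotvNl dotvC. Qed.

Lemma dotv_mul d d' (x : 'rV[F]_d) (A : 'M_(d, d')) y :
  dotv (x *m A) y = dotv x (y *m A^T).
Proof. by rewrite !dotvE trmx_mul trmxK mulmxA. Qed.

Lemma sum_chi_dotv d (z : 'rV[F]_d) :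
  \sum_x chi (dotv x z) = (#|F| ^ d)%:R * (z == 0)%:R.
Proof.
have [->|/rV0Pn[j zj]] := eqVneq z 0.
  under eq_bigr => x _ do rewrite dotvC dotvE mul0mx mxE chi0.
  by rewrite sumr_const mulr1 card_mx mul1n.
rewrite mulr0; have [a ca] := chi_nontrivial.
(* This vector has dot product [a] with [z]. *)
apply: (sum_chi_eq0 (x0 := (a / z 0 j) *: delta_mx 0 j)) => [x y|].
  exact: dotvDl.
by rewrite dotvE -scalemxAl -rowE !mxE divfK.
Qed.

Lemma sum_chi_mul (a : F) : \sum_x chi (x * a) = #|F|%:R * (a == 0)%:R.
Proof.
have [->|a0] := eqVneq a 0.
  by under eq_bigr do rewrite mulr0 chi0; rewrite sumr_const mulr1.
rewrite mulr0; have [b cb] := chi_nontrivial.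
apply: (sum_chi_eq0 (x0 := b / a)) => [x y|]; first exact: mulrDl.
by rewrite divfK.
Qed.

Local Notation q := (#|F|%:R : K).

Lemma mwHD n : {morph (@mwH F K n) : f g / f + g}.
Proof.
move=> f g; rewrite /mwH -big_split; apply: eq_bigr => i _.
by rewrite coefD scalerDl.
Qed.

Lemma mwH0 n : mwH F n (0 : {poly K}) = 0.
Proof. by rewrite /mwH big1 // => i _; rewrite coef0 scale0r. Qed.

Lemma mwHZ n c (f : {poly K}) : mwH F n (c *: f) = c *: mwH F n f.
Proof. by rewrite /mwH scaler_sumr; apply: eq_bigr => i _; rewrite coefZ scalerA. Qed.

Lemma mwH_sum n (I : Type) (r : seq I) (P : pred I) (f : I -> {poly K}) :
  mwH F n (\sum_(i <- r | P i) f i) = \sum_(i <- r | P i) mwH F n (f i).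
Proof. exact: (big_morph _ (@mwHD n) (@mwH0 n)). Qed.

Lemma mwHXn n i : (i <= n)%N -> mwH F n ('X^i : {poly K}) =
  (1 - 'X) ^+ i * (1 + (q - 1) *: 'X) ^+ (n - i).
Proof.
rewrite -ltnS => lin; rewrite /mwH (bigD1 (Ordinal lin)) //= coefXn eqxx scale1r.
rewrite big1 ?addr0 // => j ji; rewrite coefXn.
case: eqP => [e|_]; last by rewrite scale0r.
by case/eqP: ji; apply: val_inj.
Qed.

(** Character and weight both factor over the coordinates, so the sum is a product of sums over [F]:
    [1 - 'X] where [a 0 j] is nonzero, and [1 + (q - 1) *: 'X] elsewhere. *)
Lemma mwH_wt n (a : 'rV[F]_n) :
  \sum_c chi (dotv c a) *: 'X^(wt c) = mwH F n ('X^(wt a) : {poly K}).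
Proof.
pose f (j : 'I_n) (x : F) : {poly K} := chi (x * a 0 j) *: 'X^(x != 0%R).
have fE j : \sum_x f j x = if a 0 j != 0 then 1 - 'X else 1 + (q - 1) *: 'X.
  have : \sum_(x : F | x != 0) chi (x * a 0 j) = q * (a 0 j == 0)%:R - 1.
    rewrite -sum_chi_mul [in RHS](bigD1 0) //= mul0r chi0.
    by rewrite [RHS]addrC addKr.
  move=> e; rewrite (bigD1 0) //= {1}/f mul0r chi0 eqxx scale1r expr0.
  under eq_bigr => x x0 do rewrite /f x0 expr1.
  rewrite -scaler_suml e; case: eqP => _ /=; rewrite ?mulr1 // mulr0 sub0r.
  by rewrite scaleN1r.
rewrite mwHXn; last by rewrite /wt -[X in (_ <= X)%N]card_ord max_card.
transitivity (\prod_j \sum_x f j x); last first.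
  under eq_bigr do rewrite fE.
  rewrite (bigID (fun j => a 0 j != 0)) /=; congr (_ * _).
    under eq_bigr => j aj do rewrite aj.
    by rewrite prodr_const /wt; congr (_ ^+ _); apply: eq_card => j; rewrite inE.
  under eq_bigr => j aj do rewrite (negbTE aj).
  rewrite prodr_const; congr (_ ^+ _).
  have := cardsC [set j | a 0 j != 0]; rewrite card_ord => nE.
  rewrite -[X in (X - _)%N]nE addKn; apply: eq_card => j.
  by rewrite !inE.
rewrite bigA_distr_bigA /=.
rewrite (reindex (fun g : {ffun 'I_n -> F} => \row_j g j)) /=; last first.
  exists (fun c : 'rV_n => [ffun j => c 0 j]) => c _.
    by apply/ffunP => j; rewrite ffunE mxE.
  by apply/rowP => j; rewrite mxE ffunE.
apply: eq_bigr => g _; rewrite /f scaler_prod /dotv chi_sum; congr (_ *: _).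
  by apply: eq_bigr => j _; rewrite mxE.
rewrite -expr_sum /wt -sum1_card big_mkcond; congr (_ ^+ _).
by apply: eq_bigr => j _; rewrite inE mxE; case: eqP.
Qed.

(** * Matrices indexed by states and their MacWilliams transform *)

Section StateMatrices.
Variable d : nat.
Local Notation S := 'rV[F]_d.
Local Notation qd := ((#|F| ^ d)%:R : K).

Lemma state_mx_mul (R : pzSemiRingType) (f g : S -> S -> R) :
  state_mx f *m state_mx g = state_mx (fun X Y => \sum_Z f X Z * g Z Y).
Proof.
apply/matrixP => i j; rewrite !mxE.
rewrite [RHS](reindex (fun l : 'I_(states F d) => enum_val l)) /=.
  by apply: eq_bigr => l _; rewrite !mxE.
exact: (onW_bij _ (enum_val_bij _)).
Qed.

Lemma eq_state_mx (R : Type) (f g : S -> S -> R) : f =2 g -> state_mx f = state_mx g.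
Proof. by move=> fg; apply/matrixP => i j; rewrite !mxE fg. Qed.

Lemma map_state_mx (R R' : Type) (h : R -> R') (f : S -> S -> R) :
  map_mx h (state_mx f) = state_mx (fun X Y => h (f X Y)).
Proof. by apply/matrixP => i j; rewrite !mxE. Qed.

Lemma tr_state_mx (R : Type) (f : S -> S -> R) :
  (state_mx f)^T = state_mx (fun X Y => f Y X).
Proof. by apply/matrixP => i j; rewrite !mxE. Qed.

Lemma scale_state_mx (R : pzSemiRingType) c (f : S -> S -> R) :
  c *: state_mx f = state_mx (fun X Y => c * f X Y).
Proof. by apply/matrixP => i j; rewrite !mxE. Qed.

Lemma state_mx1 (R : pzSemiRingType) :
  state_mx (fun X Y : S => (X == Y)%:R) = 1%:M :> 'M[R]_(states F d).
Proof. by apply/matrixP => i j; rewrite !mxE (inj_eq enum_val_inj). Qed.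

Lemma q_neq0 : q != 0.
Proof. by rewrite pnatr_eq0 -lt0n (leq_trans _ (finNzRing_gt1 F)). Qed.

Lemma qd_neq0 : qd != 0.
Proof. by rewrite natrX expf_neq0 ?q_neq0. Qed.

(** Orthogonality of characters; the scalar is [q^(-d/2)], in a form that cancels the factor of
    [mwmx]. *)
Lemma invmx_mwmx : invmx (mwmx F p s zeta d) =
  (sqrtC (q ^+ d) / qd) *: state_mx (fun X Y => chi (- dotv X Y)).
Proof.
apply: invmx_right; rewrite /mwmx -scalemxAl -scalemxAr scalerA state_mx_mul.
have q0 := qd_neq0; have sq0 : sqrtC (q ^+ d) != 0 by rewrite sqrtC_eq0 -natrX.
rewrite mulKf // scale_state_mx -state_mx1; apply: eq_state_mx => X Y.
have dE Z : chi (dotv X Z) * chi (- dotv Z Y) = chi (dotv Z (X - Y)).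
  by rewrite -chiD [dotv Z (_ - _)]dotvC dotvDl dotvNl [dotv Y Z]dotvC.
under eq_bigr do rewrite dE.
by rewrite sum_chi_dotv subr_eq0 mulKf.
Qed.

Lemma macwilliamsE n k (f : S -> S -> {poly K}) :
  macwilliams p s zeta n k (state_mx f) = state_mx (fun X Y =>
    (q ^- k / qd) *: \sum_Z \sum_V
      (chi (dotv X Z - dotv V Y)) *: mwH F n (f V Z)).
Proof.
rewrite /macwilliams invmx_mwmx /mwmx /constmx !scale_state_mx !map_state_mx.
rewrite tr_state_mx !state_mx_mul map_state_mx; apply: eq_state_mx => X Y.
rewrite -scalerA; congr (_ *: _).
rewrite mwH_sum [X in _ = _ *: X]exchange_big scaler_sumr.
apply: eq_bigr => V _; rewrite mulr_suml mwH_sum scaler_sumr.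
apply: eq_bigr => Z _; rewrite mulrAC -polyCM mul_polyC mwHZ scalerA.
congr (_ *: _); rewrite mulrACA -chiD; congr (_ * _).
have sq0 : sqrtC (q ^+ d) != 0 by rewrite sqrtC_eq0 -natrX qd_neq0.
by rewrite mulKf.
Qed.

Lemma state_perm_conj (P : 'M[F]_d) (f : S -> S -> {poly K}) : P \in unitmx ->
  constmx (state_perm K P) *m state_mx f *m constmx (invmx (state_perm K P))
  = state_mx (fun X Y => f (X *m P) (Y *m P)).
Proof.
move=> Pu.
have -> : invmx (state_perm K P) = state_perm K (invmx P).
  apply: invmx_right; rewrite state_mx_mul -state_mx1; apply: eq_state_mx => X Y.
  rewrite (bigD1 (X *m P)) //= eqxx mul1r big1 ?addr0 => [|Z /negbTE->].
    by rewrite mulmxK // eq_sym.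
  by rewrite mul0r.
rewrite /constmx !map_state_mx !state_mx_mul; apply: eq_state_mx => X Y.
rewrite (bigD1 (Y *m P)) //= mulmxK // eqxx mulr1 [X in _ + X]big1 => [|Z ZY].
  rewrite addr0 (bigD1 (X *m P)) //= eqxx mul1r big1 ?addr0 // => Z /negbTE->.
  by rewrite mul0r.
case: eqP => [YZ|_]; last by rewrite mulr0.
by case/eqP: ZY; rewrite YZ mulmxKV.
Qed.

(** A base change of the states leaves the controller form, so arbitrary matrices are allowed;
    [adjacency] is the case of the controller form. *)
Definition adjmx n k (A : 'M[F]_d) (B : 'M[F]_(k, d)) (C : 'M[F]_(d, n))
    (D : 'M[F]_(k, n)) : 'M[{poly K}]_(states F d) :=
  state_mx (fun X Y => we K [set X *m C + u *m D
    | u : 'rV[F]_k & Y == X *m A + u *m B]).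

(** Conjugation relabels each state [X] as [X *m P], which is a base change of the system. *)
Lemma adjmx_conj n k (P A : 'M[F]_d) (B : 'M[F]_(k, d)) (C : 'M[F]_(d, n))
    (D : 'M[F]_(k, n)) : P \in unitmx ->
  constmx (state_perm K P) *m adjmx A B C D *m constmx (invmx (state_perm K P))
  = adjmx (P *m A *m invmx P) (B *m invmx P) (P *m C) D.
Proof.
move=> Pu; rewrite state_perm_conj //; apply: eq_state_mx => X Y.
have eqY u : (Y *m P == X *m P *m A + u *m B) =
    (Y == X *m (P *m A *m invmx P) + u *m (B *m invmx P)).
  by rewrite !mulmxA -mulmxDl -[RHS](can_eq (mulmxK Pu)) mulmxKV.
congr (we K); apply/setP => c.
apply/imsetP/imsetP => -[u]; rewrite inE -?eqY => Yu ->;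
  by exists u; rewrite ?inE -?eqY ?mulmxA.
Qed.

(* The dual of the row space of (1 A C; 0 B D), with the two state components
   exchanged and one of them negated, is the row space of (1 A' C'; 0 B' D'); the
   transform below is the MacWilliams identity for this pair of block codes. *)
Lemma macwilliams_adjmx n k (A : 'M[F]_d) (B : 'M[F]_(k, d)) (C : 'M[F]_(d, n))
    (D : 'M[F]_(k, n)) (A' : 'M[F]_d) (B' : 'M[F]_(n - k, d)) (C' : 'M[F]_(d, n))
    (D' : 'M[F]_(n - k, n)) :
  row_free D -> row_free D' ->
  C' *m C^T = A' - A^T -> C' *m D^T = - B^T -> D' *m C^T = B' -> D' *m D^T = 0 ->
  macwilliams p s zeta n k (adjmx A B C D) = adjmx A' B' C' D'.
Proof.
move=> Df D'f CC CD DC DD; rewrite macwilliamsE; apply: eq_state_mx => X Y.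
(* For [Z = V *m A + u *m B] and [c] from [mwH_wt], the total argument of [chi] is
   [dotv V (al c) + dotv u (ga c)]. *)
pose al c := X *m A^T - Y + c *m C^T; pose ga c := X *m B^T + c *m D^T.
have weE (V Z : S) :
    we K [set V *m C + u *m D | u : 'rV[F]_k & Z == V *m A + u *m B]
    = \sum_(u | Z == V *m A + u *m B) 'X^(wt (V *m C + u *m D)).
  (* As [D] has independent rows, distinct inputs give distinct outputs. *)
  rewrite /we big_imset /=; first by apply: eq_bigl => u; rewrite inE.
  by move=> u u' _ _ /addrI; apply: row_free_inj.
transitivity ((q ^- k / qd) *: \sum_c (\sum_V chi (dotv V (al c))) *:
    ((\sum_u chi (dotv u (ga c))) *: ('X^(wt c) : {poly K}))).
  congr (_ *: _); rewrite exchange_big.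
  under [RHS]eq_bigr do rewrite scaler_suml.
  rewrite [RHS]exchange_big; apply: eq_bigr => V _ /=.
  under [RHS]eq_bigr do rewrite scaler_suml scaler_sumr.
  rewrite [RHS]exchange_big /=.
  under eq_bigr do rewrite weE mwH_sum scaler_sumr.
  rewrite (exchange_big_dep predT) //=; apply: eq_bigr => u _.
  rewrite big_pred1_eq -mwH_wt scaler_sumr; apply: eq_bigr => c _.
  rewrite !scalerA -!chiD; congr (chi _ *: _).
  rewrite /al /ga !dotvDr dotvNr -!dotv_mul.
  by rewrite ![dotv X _]dotvC ![dotv c _]dotvC; ring.
under eq_bigr do rewrite !sum_chi_dotv !scalerA.
(* The character sums leave only the [c] with [al c = 0] and [ga c = 0]; these are the outputs of
   the dual system on its transitions from [X] to [Y]. *)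
have memS c :
    (c \in [set X *m C' + u *m D' | u : 'rV_(n - k) & Y == X *m A' + u *m B'])
    = (al c == 0) && (ga c == 0).
  apply/imsetP/andP => [[u]|[/eqP alc /eqP gac]].
    rewrite inE /al /ga => /eqP -> ->; rewrite !mulmxDl -!mulmxA CC CD DC DD.
    by rewrite mulmxN mulmx0 addr0 mulmxBr [X *m A' - _ + _]addrAC addrA subrK !subrr.
  (* This is [ga c = 0]; it puts [c - X *m C'] in the row space of [D'], and [al c = 0] then yields
     the next state [Y]. *)
  have : (c - X *m C') *m D^T = 0.
    by rewrite mulmxBl -mulmxA CD mulmxN opprK addrC.
  move/(ker_orthogonal Df D'f DD) => [u cE].
  have {}cE : c = X *m C' + u *m D' by rewrite -cE addrC subrK.
  exists u => //; rewrite inE; move/eqP: alc.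
  rewrite /al addrAC subr_eq0 => /eqP <-; rewrite cE mulmxDl -!mulmxA CC DC.
  by rewrite mulmxBr addrA [X *m A^T + _]addrC subrK.
rewrite /we scaler_sumr [RHS]big_mkcond; apply: eq_bigr => c _.
rewrite memS scalerA natrX.
have q0 := q_neq0.
case: eqP => _; case: eqP => _; rewrite ?(mulr0, mul0r, scale0r) //= !mulr1.
by rewrite natrX -mulrA mulKf ?expf_neq0 // mulVf ?scale1r ?expf_neq0.
Qed.

End StateMatrices.
End Characters.

(** * Dual encoders and nondegeneracy of the state pairing *)

Section DualCodes.
Variables (F : finFieldType) (n : nat) (C : pvset F n).

(** A right inverse of [G], evaluated at 0, is one of [G(0)]. *)
Lemma row_free_ccfD k (G : 'M[{poly F}]_(k, n)) : basic G -> row_free (ccfD G).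
Proof.
move=> [Gt GG]; apply/row_freeP; exists (ccfD Gt).
rewrite /ccfD; apply/matrixP => i j.
have := congr1 (fun A : 'M[{poly F}]_(_, _) => (A i j).[0]) GG.
rewrite !mxE horner_sum hornerMn hornerC => e; rewrite -[RHS]e.
by apply: eq_bigr => l _; rewrite !mxE hornerM.
Qed.

Section EncoderPair.
Variables (k1 k2 : nat) (H : 'M[{poly F}]_(k1, n)) (G : 'M[{poly F}]_(k2, n)).
Hypotheses (encG : encoder G C) (encH : encoder H (dual_code C)).

Lemma dual_code_encoder w : dual_code C w <-> G *m w^T = 0.
Proof.
split=> [wC | Gw v /encG.2[u ->]].
  apply/matrixP => i j; rewrite !mxE -[RHS](wC (row i G)).
    by apply: eq_bigr => l _; rewrite !mxE ord1 mulrC.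
  by apply/encG.2; exists (delta_mx 0 i); rewrite -rowE.
have : (u *m G *m w^T) 0 0 = 0 by rewrite -mulmxA Gw mulmx0 mxE.
by rewrite mxE => e; rewrite -[RHS]e; apply: eq_bigr => j _;
   rewrite [w^T _ _]mxE mulrC.
Qed.

Lemma encoder_mul_dual : G *m H^T = 0.
Proof.
apply/matrixP => i j.
have /dual_code_encoder /matrixP/(_ i 0) : dual_code C (row j H).
  by apply/encH.2; exists (delta_mx 0 j); rewrite -rowE.
by rewrite !mxE => e; rewrite -[RHS]e; apply: eq_bigr => l _; rewrite !mxE.
Qed.

(* 1 - Gt G is a projection whose columns lie in the dual code. *)
Lemma bidual (w : 'rV_n) : H *m w^T = 0 -> exists u, w = u *m G.
Proof.
move=> Hw; have [Gt GG] := encG.1; exists (w *m Gt).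
pose Q := 1%:M - Gt *m G.
have GQ : G *m Q = 0 by rewrite mulmxBr mulmx1 mulmxA GG mul1mx subrr.
have wQ : w *m Q = 0.
  apply/matrixP => i j; rewrite [RHS]mxE.
  have /encH.2[u uE] : dual_code C (col j Q)^T.
    by apply/dual_code_encoder; rewrite trmxK colE mulmxA GQ mul0mx.
  have -> : (w *m Q) i j = (w *m col j Q) i 0.
    by rewrite colE mulmxA -colE [RHS]mxE.
  by rewrite -[w *m _]trmxK trmx_mul uE -mulmxA Hw mulmx0 !mxE.
by apply/eqP; rewrite -subr_eq0 -mulmxA -[w in w - _]mulmx1 -mulmxBr wQ.
Qed.

End EncoderPair.

Section DualRealization.
Variables (k1 k2 d1 d2 : nat) (H : 'M[{poly F}]_(k1, n)) (G : 'M[{poly F}]_(k2, n)).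
Hypotheses (minG : minimal_encoder G C) (minH : minimal_encoder H (dual_code C)).
Hypotheses (hH : (\sum_(i < k1) row_degree H i)%N = d1).
Hypotheses (hG : (\sum_(i < k2) row_degree G i)%N = d2).

Lemma mul_dual_encoder : H *m G^T = 0.
Proof.
by apply: trmx_inj; rewrite trmx_mul trmxK trmx0 (encoder_mul_dual minG.1 minH.1).
Qed.

(** By antisymmetry this is [pairing_mx_tr_free] with the encoders exchanged: the words annihilated
    by [G] are generated by [H]. *)
Lemma pairing_mx_row_free : row_free (pairing_mx hH hG).
Proof.
have GH := encoder_mul_dual minG.1 minH.1.
have -> : pairing_mx hH hG = - (pairing_mx hG hH)^T.
  rewrite /pairing_mx; case: _ / hH; case: _ / hG; rewrite !castmx_id.
  rewrite tr_mxblock -mxblockN; apply: eq_mxblock => i l.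
  by apply/matrixP => b a; rewrite !mxE -pairing_antisym // mul_dual_encoder.
rewrite /row_free mxrank_opp; apply: pairing_mx_tr_free minH.2 _ => // w.
by move/(dual_code_encoder minG.1)/minH.1.2.
Qed.

Lemma pairing_mx_tr_row_free : row_free (pairing_mx hH hG)^T.
Proof.
apply: pairing_mx_tr_free minG.2 _; first exact: mul_dual_encoder.
exact: bidual minG.1 minH.1.
Qed.

(** The pairing matrix has full row and column rank, hence is square. *)
Lemma dual_degree : d1 = d2.
Proof.
have /eqP <- := pairing_mx_row_free; have /eqP := pairing_mx_tr_row_free.
by rewrite mxrank_tr.
Qed.

End DualRealization.

Variables (p s : nat) (K : numClosedFieldType) (zeta : K).
Hypotheses (p_prime : prime p) (card_F : #|F| = (p ^ s)%N).
Hypothesis zeta_prim : p.-primitive_root zeta.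

(** The condition on [P] and [Q] makes the pairing the identity in the new state coordinates, which
    turns its four relations into the hypotheses of [macwilliams_adjmx]. *)
Lemma macwilliams_conj_adjacency k d (G : 'M[{poly F}]_(k, n))
    (H : 'M[{poly F}]_(n - k, n)) (P Q : 'M[F]_d)
    (hG : (\sum_(i < k) row_degree G i)%N = d)
    (hH : (\sum_(i < n - k) row_degree H i)%N = d) :
  minimal_encoder G C -> minimal_encoder H (dual_code C) ->
  P \in unitmx -> Q \in unitmx -> Q *m pairing_mx hH hG *m P^T = 1%:M ->
  macwilliams p s zeta n k (constmx (state_perm K P) *m adjacency K hG
     *m constmx (invmx (state_perm K P)))
  = constmx (state_perm K Q) *m adjacency K hH *m constmx (invmx (state_perm K Q)).
Proof.
move=> minG minH Pu Qu QMP; have HG := mul_dual_encoder minG minH.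
have MP : pairing_mx hH hG *m P^T = invmx Q.
  by apply/esym/invmx_right; rewrite mulmxA.
have QM : Q *m pairing_mx hH hG = (invmx P)^T.
  rewrite trmx_inv -(mulmxK (_ : P^T \in unitmx) (Q *m _)) ?unitmx_tr //.
  by rewrite QMP mul1mx.
rewrite !(adjmx_conj K _ _ _ _ Pu) !(adjmx_conj K _ _ _ _ Qu).
apply: (macwilliams_adjmx p_prime card_F zeta_prim).
- exact: row_free_ccfD minG.1.1.
- exact: row_free_ccfD minH.1.1.
- rewrite trmx_mul mulmxA -[Q *m _ *m _]mulmxA (ccfC_mul_tr hH hG HG).
  rewrite mulmxBr mulmxBl !trmx_mul -QM -!mulmxA -MP.
  by [].
- by rewrite -mulmxA (ccfC_mul_trD hH hG HG) mulmxN mulmxA QM trmx_mul.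
- by rewrite trmx_mul mulmxA (ccfD_mul_trC hH hG HG) -mulmxA MP.
- exact: ccfD_mul_tr HG.
Qed.

End DualCodes.

Theorem theorem5p12 (F : finFieldType) (p s : nat)
    (p_prime : prime p) (card_F : #|F| = (p ^ s)%N)
    (K : numClosedFieldType) (zeta : K) (zeta_prim : p.-primitive_root zeta)
    (n k delta : nat) (C : pvset F n) (C_code : conv_code k delta C)
    (e ehat : seq nat)
    (e_forney : forney_indices k C e)
    (ehat_forney : forney_indices (n - k) (dual_code C) ehat)
    (r rhat : nat)
    (r_def : r = count (fun d => d != 0%N) e)
    (rhat_def : rhat = count (fun d => d != 0%N) ehat)
    (r_or_rhat : r = delta \/ rhat = delta) :
  forall Lhat : 'M[{poly K}]_(states F delta),
    gen_adjacency (n - k) (dual_code C) Lhat <->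
    exists2 L : 'M[{poly K}]_(states F delta),
      gen_adjacency k C L & Lhat = macwilliams p s zeta n k L.
Proof.
move=> Lhat; case: e_forney => G0 minG0 _.
case: ehat_forney => H0 minH0 _; split.
- case=> [H [hH [Q [minH Qu ->]]]].
  have hG := esym (dual_degree minG0 minH hH (erefl _)).
  have Mu : pairing_mx hH hG \in unitmx.
    by rewrite -row_free_unit (pairing_mx_row_free minG0 minH).
  have QMu : Q *m pairing_mx hH hG \in unitmx by rewrite unitmx_mul Qu.
  (* The base change for [G0] that normalizes the pairing, given [Q]. *)
  set P := (invmx (Q *m pairing_mx hH hG))^T.
  have Pu : P \in unitmx by rewrite unitmx_tr unitmx_inv.
  exists (constmx (state_perm K P) *m adjacency K hG
      *m constmx (invmx (state_perm K P))).
    by exists G0, hG, P.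
  by rewrite (macwilliams_conj_adjacency p_prime card_F zeta_prim minG0 minH Pu Qu) //
     trmxK mulmxV.
- case=> [_ [G [hG [P [minG Pu ->]]]] ->].
  have hH := dual_degree minG minH0 (erefl _) hG.
  have Mu : pairing_mx hH hG \in unitmx.
    by rewrite -row_free_unit (pairing_mx_row_free minG minH0).
  have MPu : pairing_mx hH hG *m P^T \in unitmx by rewrite unitmx_mul Mu unitmx_tr.
  (* The same normalization, solved for the base change on the dual side. *)
  exists H0, hH, (invmx (pairing_mx hH hG *m P^T)); split; rewrite ?unitmx_inv //.
  apply: (macwilliams_conj_adjacency p_prime card_F zeta_prim minG minH0 Pu) => //.
    by rewrite unitmx_inv.
  by rewrite -mulmxA mulVmx.
Qed.
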